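(* Let $\mathcal{A}$ be a commutative C*-algebra, let $a_1, a_2 \in \mathcal{A}$, and let $P(z) = (z-a_1)(z-a_2)$ for $z \in \mathcal{A}$ (a polynomial of degree $2$ over $\mathcal{A}$). If $z \in \mathcal{A}$ is not a critical point of $P$, then there exists a critical point $w \in \mathcal{A}$ of $P$ such that $$\frac{\|P'(z)\|}{2} \leq \frac{\|P(z)-P(w)\|}{\|z-w\|}.$$
   Context: C*-algebras are complex and not assumed unital. For $P(z) = (z-a_1)(z-a_2)$ with $a_1,a_2 \in \mathcal{A}$, the derivative is defined by $P'(z) = (z-a_2) + (z-a_1)$ for all $z \in \mathcal{A}$ (the sum over $j$ of the product with the factor $z-a_j$ omitted). An element $w \in \mathcal{A}$ is a critical point of $P$ if $P'(w) = 0$; thus $z$ is not a critical point of $P$ if $P'(z) \neq 0$, and then $z \neq w$ for every critical point $w$. *)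

(* Defs.v *)
From HB Require Import structures.
From mathcomp Require Import all_boot all_order all_algebra.
From mathcomp Require Import complex.
From mathcomp Require Import all_classical all_reals all_analysis.

Set Implicit Arguments.
Unset Strict Implicit.
Unset Printing Implicit Defensive.

Import Order.TTheory GRing.Theory Num.Theory.
Import numFieldNormedType.Exports.

Local Open Scope ring_scope.

(* MathComp rings are unital, so the product of a possibly non-unital
   C*-algebra is part of the structure.  The underlying Banach space is a
   complete normed module over R[i]; its norm takes values in R[i], where
   x <= y means that y - x is a nonnegative real number. *)
HB.mixin Record Banach_isCStarAlgebra (R : realType) A
    of CompleteNormedModule R[i] A := {
  cstar_mul : A -> A -> A ;
  cstar_star : A -> A ;
  cstar_mulA : associative cstar_mul ;
  cstar_mulDl : left_distributive cstar_mul +%R ;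
  cstar_mulDr : right_distributive cstar_mul +%R ;
  cstar_mulZl : forall (c : R[i]) (x y : A),
    cstar_mul (c *: x) y = c *: cstar_mul x y ;
  cstar_mulZr : forall (c : R[i]) (x y : A),
    cstar_mul x (c *: y) = c *: cstar_mul x y ;
  cstar_norm_mul : forall x y : A, `|cstar_mul x y| <= `|x| * `|y| ;
  cstar_starK : involutive cstar_star ;
  cstar_starD : {morph cstar_star : x y / x + y} ;
  cstar_starZ : forall (c : R[i]) (x : A),
    cstar_star (c *: x) = c^* *: cstar_star x ;
  cstar_starM : forall x y : A,
    cstar_star (cstar_mul x y) = cstar_mul (cstar_star y) (cstar_star x) ;
  cstar_norm_star : forall x : A, `|cstar_mul (cstar_star x) x| = `|x| ^+ 2
}.

#[short(type="cstarAlgType")]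
HB.structure Definition CStarAlgebra (R : realType) :=
  {A of CompleteNormedModule R[i] A & Banach_isCStarAlgebra R A}.

HB.mixin Record CStarAlgebra_isCommutative (R : realType) A
    of CStarAlgebra R A := {
  cstar_mulC : commutative (@cstar_mul R A)
}.

#[short(type="comCStarAlgType")]
HB.structure Definition ComCStarAlgebra (R : realType) :=
  {A of CStarAlgebra R A & CStarAlgebra_isCommutative R A}.

Notation "x ** y" := (cstar_mul x y) (at level 40, left associativity)
  : ring_scope.

Section QuadraticPolynomial.
Variables (R : realType) (A : cstarAlgType R).

Definition quad_poly (a1 a2 z : A) : A := (z - a1) ** (z - a2).

Definition quad_deriv (a1 a2 z : A) : A := (z - a2) + (z - a1).

Definition critical_point (a1 a2 w : A) : Prop := quad_deriv a1 a2 w = 0.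

End QuadraticPolynomial.

(* Main.v *)
Require Import Defs.
From mathcomp Require Import all_boot all_order all_algebra.
From mathcomp Require Import complex.
From mathcomp Require Import all_classical all_reals all_analysis.

Import Order.TTheory GRing.Theory Num.Theory.
Import numFieldNormedType.Exports.
Local Open Scope ring_scope.

(** The midpoint [w] of [a1] and [a2] is a critical point, and with [d = z - w]
    one has [P'(z) = 2 d] and [P(z) - P(w) = d^2].  In a commutative C*-algebra
    every element is normal, so [|d^2| = |d|^2] and equality holds. *)

Lemma cstar_mulN (R : realType) (A : cstarAlgType R) (x y : A) :
  x ** (- y) = - (x ** y).
Proof. by rewrite -scaleN1r cstar_mulZr scaleN1r. Qed.

(** Both sides are nonnegative, so their squares are compared. The C*-identity for [x ** x] and for
    the self-adjoint [y] turns these into norms of products of two [cstar_star x] and two [x], which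
    agree after swapping the middle factors. *)
Lemma cstar_norm_sqr (R : realType) (A : comCStarAlgType R) (x : A) :
  `|x ** x| = `|x| ^+ 2.
Proof.
apply/eqP; rewrite -(eqrXn2 (n := 2)) ?exprn_ge0 ?normr_ge0 //; apply/eqP.
set y := cstar_star x ** x.
have y_sa : cstar_star y = y by rewrite /y cstar_starM cstar_starK.
rewrite -[in RHS](cstar_norm_star x) -/y -[RHS]cstar_norm_star y_sa.
rewrite -cstar_norm_star cstar_starM /y; congr `|_|.
rewrite -!cstar_mulA; congr (_ ** _).
by rewrite !cstar_mulA; congr (_ ** _); rewrite cstar_mulC.
Qed.

Lemma cstar_mul_add_sub (R : realType) (A : comCStarAlgType R) (x y : A) :
  (x + y) ** (x - y) = x ** x - y ** y.
Proof.
rewrite cstar_mulDl !cstar_mulDr !cstar_mulN (cstar_mulC y x).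
by rewrite addrA subrK.
Qed.

Theorem theorem3p3 (R : realType) (A : comCStarAlgType R) (a1 a2 z : A)
  (hz : ~ critical_point a1 a2 z) :
  exists w : A, critical_point a1 a2 w /\
    `|quad_deriv a1 a2 z| / 2 <=
      `|quad_poly a1 a2 z - quad_poly a1 a2 w| / `|z - w|.
Proof.
pose w : A := 2^-1 *: (a1 + a2).
(* Half the difference of the roots: [a1 = w - h] and [a2 = w + h]. *)
pose h : A := w - a1.
have w2 : w + w = a1 + a2.
  by rewrite /w -scalerDl -[2^-1]div1r -splitr scale1r.
have wa2 : w - a2 = - h.
  by rewrite /h opprB; apply/eqP; rewrite subr_eq addrAC eq_sym subr_eq eq_sym w2.
have wcrit : critical_point a1 a2 w.
  by rewrite /critical_point /quad_deriv wa2 addNr.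
exists w; split=> //.
set d := z - w.
have za1 : z - a1 = d + h by rewrite /d /h addrA subrK.
have za2 : z - a2 = d - h by rewrite -wa2 /d addrA subrK.
(* Since [w] is critical and [z] is not, they differ; this allows cancelling [|d|] in the
   quotient. *)
have d_neq0 : `|d| != 0.
  rewrite normr_eq0 subr_eq0; apply/eqP => zw.
  by apply: hz; rewrite zw.
have -> : quad_deriv a1 a2 z = 2 *: d.
  by rewrite /quad_deriv za1 za2 addrACA addNr addr0 scaler_nat mulr2n.
(* Centred at [w], P(z) = d^2 - h^2 and P(w) = -h^2. *)
have -> : quad_poly a1 a2 z - quad_poly a1 a2 w = d ** d.
  rewrite /quad_poly za1 za2 wa2 -/h cstar_mul_add_sub cstar_mulN.
  by rewrite opprK subrK.
rewrite cstar_norm_sqr normrZ normr_nat expr2 mulfK //.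
by rewrite mulrAC divff ?pnatr_eq0 // mul1r.
Qed.
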